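(* Let $T>0$, $N\ge1$, $X=W^{1,2}(0,T;\mathbb{R}^N)$ and $p_0,q_0\in\mathbb{R}^N$. Suppose $H:\mathbb{R}^N\times\mathbb{R}^N\to\mathbb{R}$ is a proper convex lower semi-continuous function such that $H(p,q)\to\infty$ as $|p|+|q|\to\infty$, and assume that for some positive constants $\alpha,\beta$ and some $1<r<\infty$, $$-\alpha\le H(p,q)\le\beta(|p|^r+|q|^r+1)\qquad\text{for all }(p,q)\in\mathbb{R}^N\times\mathbb{R}^N.$$ Then the infimum of the functional $$J(p,q)=\int_0^T\big[H(p(t),q(t))+H^*(-\dot q(t),\dot p(t))+\dot q(t)\cdot p(t)-\dot p(t)\cdot q(t)\big]\,dt$$ on the set $D=\{(p,q)\in X\times X:\ p(0)=p_0,\ q(0)=q_0\}$ is equal to zero and is attained at a solution $(p,q)\in D$ of $$\dot p(t)\in\partial_2H(p(t),q(t)),\qquad-\dot q(t)\in\partial_1H(p(t),q(t))\qquad\text{for }t\in(0,T),\qquad (p(0),q(0))=(p_0,q_0).$$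
   Context: $H^*$ denotes the Legendre-Fenchel conjugate of $H$ on $\mathbb{R}^N\times\mathbb{R}^N$ with respect to $(p,q)\cdot(r,s)=p\cdot r+q\cdot s$, i.e. $H^*(y)=\sup_x\{x\cdot y-H(x)\}\in(-\infty,+\infty]$. $\partial_1H$, $\partial_2H$ are the partial convex subdifferentials of $H$ with respect to its first and second $\mathbb{R}^N$-variable. Inclusions involving derivatives of Sobolev functions are understood for almost every $t$; values at $0$ are those of the continuous representatives. $J$ takes values in $(-\infty,+\infty]$. *)

(* Defs.v *)
From HB Require Import structures.
From mathcomp Require Import all_boot all_order all_algebra.
From mathcomp Require Import all_classical all_reals all_analysis.

Set Implicit Arguments.
Unset Strict Implicit.
Unset Printing Implicit Defensive.

Import Order.TTheory GRing.Theory Num.Theory.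
Import numFieldNormedType.Exports.

Local Open Scope classical_set_scope.
Local Open Scope ring_scope.

Section Euclidean.
Context {R : realType} {N : nat}.

Definition dotp (u v : 'rV[R]_N) : R := \sum_(i < N) u 0 i * v 0 i.

(* The library's norm on row vectors is the sup norm. *)
Definition enorm (u : 'rV[R]_N) : R := Num.sqrt (dotp u u).

Definition dotp2 (x y : 'rV[R]_N * 'rV[R]_N) : R :=
  dotp x.1 y.1 + dotp x.2 y.2.

End Euclidean.

Section ConvexAnalysis.
Context {R : realType} {N : nat}.

(* Automatic when f is real-valued. *)
Definition proper_function {V : Type} (f : V -> \bar R) : Prop :=
  (exists x, (f x < +oo)%E) /\ (forall x, (-oo < f x)%E).

Definition coercive (H : 'rV[R]_N * 'rV[R]_N -> R) : Prop :=
  forall A : R, exists M : R,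
    forall p q, M <= enorm p + enorm q -> A <= H (p, q).

Definition conjugate (H : 'rV[R]_N * 'rV[R]_N -> R)
    (y : 'rV[R]_N * 'rV[R]_N) : \bar R :=
  ereal_sup [set (dotp2 x y - H x)%:E | x in setT].

Definition subdiff (f : 'rV[R]_N -> R) (x : 'rV[R]_N) : set 'rV[R]_N :=
  [set s | forall y, f x + dotp s (y - x) <= f y].

Definition subdiff1 (H : 'rV[R]_N * 'rV[R]_N -> R) (p q : 'rV[R]_N) :=
  subdiff (fun p' => H (p', q)) p.

Definition subdiff2 (H : 'rV[R]_N * 'rV[R]_N -> R) (p q : 'rV[R]_N) :=
  subdiff (fun q' => H (p, q')) q.

End ConvexAnalysis.

Section Sobolev.
Context {R : realType}.
Local Notation mu := (@lebesgue_measure R).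

Definition square_integrable (T : R) (N : nat) (u : R -> 'rV[R]_N) : Prop :=
  (forall i, measurable_fun `]0, T[ (fun t => u t 0 i)) /\
  (\int[mu]_(t in `]0%R, T[) (enorm (u t) ^+ 2)%R%:E < +oo)%E.

Definition test_function (T : R) (phi : R -> R) : Prop :=
  [/\ forall n x, derivable (derive1n n phi) x 1,
      compact (closure [set x | phi x != 0]) &
      closure [set x | phi x != 0] `<=` `]0, T[ ].

Definition weak_derivative (T : R) (N : nat) (u v : R -> 'rV[R]_N) : Prop :=
  forall phi, test_function T phi -> forall i,
    \int[mu]_(t in `]0, T[) (u t 0 i * derive1 phi t) =
    - \int[mu]_(t in `]0, T[) (v t 0 i * phi t).

(* W^{1,2}(0,T; R^N): an element consists of the continuous representative on
   [0, T] together with its weak derivative, which is unique almost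
   everywhere on (0, T).  Values outside [0, T] are irrelevant. *)
Record W12 (T : R) (N : nat) := {
  w12_fun :> R -> 'rV[R]_N ;
  w12_deriv : R -> 'rV[R]_N ;
  w12_continuous : {within `[0, T], continuous w12_fun} ;
  w12_fun_L2 : square_integrable T w12_fun ;
  w12_deriv_L2 : square_integrable T w12_deriv ;
  w12_weak : weak_derivative T w12_fun w12_deriv }.

End Sobolev.

Section Hamiltonian.
Context {R : realType} {T : R} {N : nat}.
Local Notation mu := (@lebesgue_measure R).

(* By the Fenchel-Young inequality the integrand is nonnegative. *)
Definition J (H : 'rV[R]_N * 'rV[R]_N -> R) (x : W12 T N * W12 T N) : \bar R :=
  let: (p, q) := x in
  let p' := w12_deriv p in
  let q' := w12_deriv q in
  (\int[mu]_(t in `]0%R, T[) ((H (p t, q t))%:E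
      + conjugate H (- q' t, p' t)%R
      + (dotp (q' t) (p t))%:E - (dotp (p' t) (q t))%:E))%E.

Definition D (p0 q0 : 'rV[R]_N) : set (W12 T N * W12 T N) :=
  [set x | w12_fun x.1 0 = p0 /\ w12_fun x.2 0 = q0].

Definition hamiltonian_solution (H : 'rV[R]_N * 'rV[R]_N -> R)
    (p0 q0 : 'rV[R]_N) (x : W12 T N * W12 T N) : Prop :=
  let: (p, q) := x in
  {ae mu, forall t, t \in `]0, T[ ->
     subdiff2 H (p t) (q t) (w12_deriv p t) /\
     subdiff1 H (p t) (q t) (- w12_deriv q t)} /\
  (p 0, q 0) = (p0, q0).

End Hamiltonian.

(* Main.v *)
(** By the Fenchel-Young inequality the integrand of [J] is nonnegative, and it
    vanishes exactly where [(- q', p')] is a subgradient of [H] at [(p, q)], so it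
    suffices to solve the inclusion [x' \in (subdiff H x) A] on [[0, T]], with
    [A] the symplectic matrix.  Replace [H] by a globally Lipschitz convex
    function [G <= H] that agrees with [H] on a large ball, and run the explicit
    Euler scheme for a selection of subgradients of [G].  A pointwise limit of
    the piecewise constant Euler curves along an ultrafilter is a Lipschitz curve
    [x], and averaging the subgradient inequalities over the steps between [t]
    and [t + h] shows that [x] solves the inclusion for [G] at every point of
    differentiability.  There a subgradient is orthogonal to [x'], so [G] is
    constant along [x]; by coercivity [x] never leaves the ball, where the
    inclusion for [G] implies the one for [H]. *)

Require Import Defs.
From HB Require Import structures.
From mathcomp Require Import all_boot all_order all_algebra.
From mathcomp Require Import all_classical all_reals all_analysis.
From mathcomp Require Import measurable_realfun ring lra.

Set Implicit Arguments.
Unset Strict Implicit.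
Unset Printing Implicit Defensive.

Import Order.TTheory GRing.Theory Num.Theory.
Import numFieldNormedType.Exports.

Local Open Scope classical_set_scope.
Local Open Scope ring_scope.

(** * Lipschitz functions as integrals of their almost everywhere derivative *)

Section LipschitzDensity.
Context {R : realType}.
Local Notation mu := (@lebesgue_measure R).

Lemma lebesgue_stieltjes_ocitv (F : cumulative R R) (s t : R) : s <= t ->
  lebesgue_stieltjes_measure F `]s, t]%classic = (F t - F s)%:E.
Proof.
move=> st; rewrite /lebesgue_stieltjes_measure /measure_extension.
by rewrite measurable_mu_extE; [exact: wlength_itv_bnd|exact: is_ocitv].
Qed.

Lemma lipschitz_continuous (V : normedModType R) (F : R -> V) (L : R) :
  (forall s t, `|F s - F t| <= L * `|s - t|) -> continuous F.
Proof.
move=> FL t; apply/cvgrPdist_lt => e e0; near=> s.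
apply: le_lt_trans (FL t s) _.
have L0 : 0 < `|L| + 1 by rewrite ltr_wpDl.
have : `|t - s| < e / (`|L| + 1).
  by near: s; apply: cvgr_dist_lt; [exact: cvg_id|rewrite divr_gt0].
rewrite ltr_pdivlMr// => h; apply: le_lt_trans h.
rewrite mulrC ler_wpM2l//; apply: le_trans (ler_norm L) _; by rewrite lerDl.
Unshelve. all: by end_near. Qed.

(** Slopes in [[0, 1]] make both [F] and [t - F t] nondecreasing. Their Stieltjes measures add up to
    Lebesgue measure, so the one of [F] is absolutely continuous; its Radon-Nikodym density is the
    derivative of [F] almost everywhere by Lebesgue differentiation. *)
Lemma nondecreasing_density (F : R -> R) (a b : R) :
  (forall s t, s <= t -> 0 <= F t - F s <= t - s) -> a <= b ->
  exists v : R -> R,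
  [/\ mu.-integrable setT (EFin \o v),
      forall s t, a <= s -> s <= t -> t <= b ->
        (\int[mu]_(x in `]s, t]) (v x)%:E = (F t - F s)%:E)%E &
      {ae mu, forall x, a < x < b -> is_derive x 1 F (v x)}].
Proof.
move=> Fst ab.
have Fc : continuous F.
  apply: (@lipschitz_continuous _ _ 1) => s t; rewrite mul1r.
  wlog ts : s t / t <= s.
    by move=> h; case: (leP t s) => [/h//|/ltW/h]; rewrite distrC (distrC t).
  have /andP[? ?] := Fst _ _ ts.
  by rewrite !ger0_norm// subr_ge0.
pose G t := t - F t.
have Gc : continuous G by move=> t; apply: cvgB; [exact: cvg_id|exact: Fc].
have Fnd : nondecreasing F.
  by move=> s t st; have /andP[h _] := Fst _ _ st; rewrite -subr_ge0.
have Gnd : nondecreasing G.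
  move=> s t st; have /andP[_ h] := Fst _ _ st; rewrite /G; lra.
pose mF := isCumulative.Build R _ R F Fnd (right_continuousW Fc).
pose FF : cumulative R R := HB.pack F mF.
pose mG := isCumulative.Build R _ R G Gnd (right_continuousW Gc).
pose GG : cumulative R R := HB.pack G mG.
pose nF := lebesgue_stieltjes_measure FF.
pose nG := lebesgue_stieltjes_measure GG.
(* The sum of the two measures gives half-open intervals their length, which characterises Lebesgue
   measure. *)
have FG A : measurable A -> mu A = (nF A + nG A)%E.
  move=> mA.
  rewrite -(measure_addE nF nG A).
  apply: (@lebesgue_measure_unique _ (measure_add nF nG)) => //.
  move=> X [[s t] _ <-] /=; rewrite [RHS]measure_addE.
  case: (leP s t) => st; last first.
    by rewrite set_itv_ge ?bnd_simp ?measure0 ?adde0// -leNgt ltW.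
  rewrite lebesgue_measure_itv/= lte_fin /nF /nG !lebesgue_stieltjes_ocitv//=.
  move: st; rewrite le_eqVlt => /predU1P[->|->].
    by rewrite ltxx !subrr adde0.
  by rewrite -!EFinD /G; congr EFin; lra.
have mD : measurable (`]a, b]%classic : set (measurableTypeR R)).
  exact: measurable_itv.
have nFD : (nF `]a, b]%classic < +oo)%E.
  by rewrite /nF lebesgue_stieltjes_ocitv// ltry.
have dom : mfrestr mD nFD `<< mu.
  apply/null_content_dominatesP => A mA A0.
  have : (nF A <= 0)%E by have := FG _ mA; rewrite A0 => ->; rewrite leeDl.
  rewrite /= /mfrestr /mrestr => nFA; apply/eqP; rewrite eq_le measure_ge0 andbT.
  apply: le_trans nFA; apply: le_measure; rewrite ?inE//; exact: measurableI.
have [f [f0 ffin fint fE]] :=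
  radon_nikodym_sigma_finite dom.
have fineE : EFin \o (fine \o f) = f.
  by apply/funext => x /=; rewrite fineK.
exists (fine \o f); rewrite fineE.
have intv s t : a <= s -> s <= t -> t <= b ->
    (\int[mu]_(x in `]s, t]) f x = (F t - F s)%:E)%E.
  move=> as_ st tb; rewrite -fE; last exact: measurable_itv.
  rewrite /= /mfrestr /mrestr setIidl; last first.
    by move=> x /=; rewrite !in_itv/= => /andP[? ?]; apply/andP; split; lra.
  by rewrite /nF lebesgue_stieltjes_ocitv.
split => //.
  by move=> s t as_ st tb; rewrite -intv//; apply: eq_integral => x _ /=; rewrite fineK.
have int_itv (i : interval R) : mu.-integrable [set` i] (EFin \o (fine \o f)).
  by rewrite fineE; apply: integrableS fint => //; exact: measurable_itv.
have := @FTC1Ny R (fine \o f) (fun y => int_itv `]-oo, y]).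
have locf : locally_integrable setT (fine \o f).
  have := @integrable_locally R (fine \o f) setT measurableT.
  by rewrite patch_setT fineE; exact.
move=> /(_ locf); apply: filterS; first exact: (ae_filter_ringOfSetsType mu).
move=> x [dI vI] /andP[ax xb].
set I := fun y => \int[mu]_(t in `]-oo, y]) (fine \o f) t in dI vI.
(* The differentiated primitive [I] starts at [-oo]; inside the interval it differs from [F] by a
   constant only. *)
have IE y : a < y -> y <= b -> I y = F y + (I a - F a).
  move=> ay yb; have h : I y - I a = F y - F a.
    rewrite (@Rintegral_itvB R (fine \o f) (BInfty _ true) (BRight y) a) ?bnd_simp ?ltW//.
    rewrite /Rintegral; under eq_integral do rewrite /= fineK//.
    by rewrite intv// ltW.
  lra.
move: vI; rewrite derive1E => vI.
have : is_derive x 1 (I - cst (I a - F a)) ((fine \o f) x).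
  rewrite -[X in is_derive _ _ _ X]subr0; apply: is_deriveB; exact: DeriveDef.
apply: near_eq_is_derive.
near=> y; rewrite /= ![in LHS]fctE IE; first lra.
- by near: y; exact: lt_nbhsr.
- by apply/ltW; near: y; exact: lt_nbhsl.
Unshelve. all: by end_near. Qed.


Lemma bounded_integrable_oo (v : R -> R) (C s t : R) :
  measurable_fun `]s, t[ v -> (forall x, x \in `]s, t[ -> `|v x| <= C) ->
  mu.-integrable `]s, t[ (EFin \o v).
Proof.
move=> mv vC; apply: measurable_bounded_integrable => //.
  by rewrite /= lebesgue_measure_itv/=; case: ifP => _; rewrite ?ltry// -EFinB ltry.
exists C; split; first exact: num_real.
by move=> M CM x xst; apply: le_trans (ltW CM); apply: vC.
Qed.

Lemma Rintegral_oo_cst (s t c : R) : s <= t ->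
  \int[mu]_(x in `]s, t[) c = c * (t - s).
Proof.
move=> st; rewrite Rintegral_cst//= lebesgue_measure_itv/= lte_fin.
by move: st; rewrite le_eqVlt => /predU1P[->|->]//=; rewrite ltxx subrr.
Qed.

Lemma is_derive_quotient_cvg (g : R -> R) (x d : R) : is_derive x 1 g d ->
  h^-1 * (g (x + h) - g x) @[h --> 0^'] --> d.
Proof.
case=> dg <-; rewrite (_ : (fun h => _) =
   (fun h => h^-1 *: ((g \o shift x) (h *: 1) - g x))); first exact: dg.
by apply/funext => h; rewrite /= /GRing.scale/= mulr1 (addrC x).
Qed.

Lemma is_derive_le_lipschitz (g : R -> R) (x d K : R) :
  (forall s t, `|g s - g t| <= K * `|s - t|) -> is_derive x 1 g d -> `|d| <= K.
Proof.
move=> gK /is_derive_quotient_cvg/cvg_norm dg; apply: (cvgr_to_le dg).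
near=> h; have h0 : h != 0 by near: h; exact: nbhs_dnbhs_neq.
rewrite normrM normfV mulrC ler_pdivrMr ?normr_gt0//.
by apply: le_trans (gK _ _) _; rewrite addrAC subrr add0r.
Unshelve. all: by end_near. Qed.

(** After extending [f] to the line, an affine change of the values brings all slopes into [[0, 1]],
    where [nondecreasing_density] applies; the change is then undone on the density. *)
Lemma lipschitz_density (f : R -> R) (L a b : R) : a < b -> 0 <= L ->
  (forall s t, a <= s <= b -> a <= t <= b -> `|f s - f t| <= L * `|s - t|) ->
  exists v : R -> R, exists C : R,
  [/\ measurable_fun setT v, forall x, `|v x| <= C,
      forall s t, a <= s -> s <= t -> t <= b ->
        \int[mu]_(x in `]s, t[) v x = f t - f s &
      {ae mu, forall x, a < x < b -> is_derive x 1 f (v x)}].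
Proof.
move=> ab L0 fL.
(* The projection onto [[a, b]] is nondecreasing and 1-Lipschitz, so [f \o cl] extends [f] with the
   same Lipschitz constant. *)
pose cl x := Num.max a (Num.min b x).
have clin x : a <= cl x <= b.
  by rewrite /cl le_max lexx/= ge_max (ltW ab)/= ge_min lexx.
have clid x : a <= x <= b -> cl x = x.
  by move=> /andP[ax xb]; rewrite /cl (min_idPr xb) (max_idPr ax).
have clle s t : s <= t -> 0 <= cl t - cl s <= t - s.
  move=> st; rewrite /cl.
  case: (leP b s); case: (leP b t); case: (leP a b); case: (leP a s);
    case: (leP a t) => *; apply/andP; split; lra.
pose g := f \o cl.
(* The added 1 keeps the divisor [2 * K] positive when [L = 0]. *)
pose K := L + 1; have K0 : 0 < K by rewrite ltr_wpDl.
have gle s t : s <= t -> `|g t - g s| <= L * (t - s).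
  move=> st; have /andP[c0 cst] := clle _ _ st.
  apply: le_trans (fL _ _ (clin _) (clin _)) _.
  by rewrite ger0_norm// ler_wpM2l.
have gK s t : `|g s - g t| <= K * `|s - t|.
  wlog st : s t / t <= s.
    by move=> h; case: (leP t s) => [/h//|/ltW/h]; rewrite distrC (distrC t).
  apply: le_trans (gle _ _ st) _; rewrite ger0_norm ?subr_ge0//.
  by rewrite ler_wpM2r ?subr_ge0// /K lerDl.
(* [K * x + g x] has slopes between 0 and [2 * K]. *)
pose F x := (2 * K)^-1 * (K * x + g x).
have Fst s t : s <= t -> 0 <= F t - F s <= t - s.
  move=> st; have : `|g t - g s| <= K * (t - s).
    by have := gK t s; rewrite [X in K * X]ger0_norm// subr_ge0.
  rewrite ler_norml => /andP[h1 h2].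
  have -> : F t - F s = (K * t + g t - (K * s + g s)) / (2 * K).
    by rewrite /F -mulrBr mulrC.
  by apply/andP; split; rewrite ?ler_pdivrMr ?ler_pdivlMr ?mulr_gt0//; lra.
have [w [iw wE dw]] := nondecreasing_density Fst (ltW ab).
have gE x : g x = 2 * K * F x - K * x.
  by rewrite /F mulVKf ?gt_eqF ?mulr_gt0//; lra.
pose v0 x := 2 * K * w x - K.
(* Truncation makes the bound hold everywhere. Where [g] has derivative [v0 x], that value already
   lies in [[- K, K]], so almost nothing changes. *)
pose v x := Num.max (- K) (Num.min K (v0 x)).
have mw : measurable_fun setT w by apply/measurable_EFinP; exact: measurable_int iw.
have mv0 : measurable_fun setT v0.
  by apply: measurable_funB => //; exact: measurable_funM.
have mv : measurable_fun setT v.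
  by apply: measurable_maxr => //; exact: measurable_minr.
have vK x : `|v x| <= K.
  rewrite ler_norml /v le_max lexx/= ge_max ge_min lexx/= andbT; lra.
have dv0 : {ae mu, forall x, a < x < b -> is_derive x 1 g (v0 x)}.
  apply: filterS dw; first exact: (ae_filter_ringOfSetsType mu).
  move=> x h axb; have := h axb => dF.
  rewrite (_ : g = (2 * K) *: F - K *: id); last first.
    by apply/funext => y; rewrite gE.
  rewrite (_ : v0 x = (2 * K) *: w x - K *: 1); last first.
    by rewrite /v0 /GRing.scale/= mulr1.
  exact: is_deriveB.
have v0v (x : R) : is_derive x 1 g (v0 x) -> v0 x = v x.
  move=> /(is_derive_le_lipschitz gK); rewrite ler_norml => /andP[h1 h2].
  by rewrite /v (min_idPr h2) (max_idPr h1).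
exists v, K; split => //.
- move=> s t as_ st tb.
  have -> : \int[mu]_(x in `]s, t[) v x = \int[mu]_(x in `]s, t[) v0 x.
    congr fine; apply: ae_eq_integral => //.
    + by apply/measurable_EFinP; exact: measurable_funTS.
    + by apply/measurable_EFinP; exact: measurable_funTS.
    + apply: filterS dv0; first exact: (ae_filter_ringOfSetsType mu).
      move=> x h; rewrite /= in_itv/= => /andP[sx xt].
      suff /v0v -> : is_derive x (1 : R) g (v0 x) by [].
      by apply: h; rewrite (le_lt_trans as_ sx) (lt_le_trans xt tb).
  have iw' : mu.-integrable `]s, t[ (EFin \o w) by apply: integrableS iw.
  rewrite RintegralB//; last 2 first.
  + have -> : EFin \o (fun x => 2 * K * w x) = (fun x => ((2 * K)%:E * (w x)%:E)%E).
      by apply/funext => x /=; rewrite EFinM.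
    exact: integrableZl.
  + by apply: (@bounded_integrable_oo _ `|K|) => //.
  rewrite RintegralZl// Rintegral_oo_cst// Rintegral_itv_bndo_bndc; last first.
    by apply: integrableS iw'.
  rewrite /Rintegral wE//=.
  have gf u : a <= u <= b -> f u = g u by move=> /clid; rewrite /g /= => ->.
  rewrite (gf t) ?tb ?(le_trans as_ st)// (gf s) ?as_ ?(le_trans st tb)//.
  by rewrite !gE; ring.
- apply: filterS dv0; first exact: (ae_filter_ringOfSetsType mu).
  move=> x h axb; have dg := h axb; rewrite -(v0v _ dg).
  move: axb => /andP[ax xb].
  apply: near_eq_is_derive dg; near=> y; rewrite /g /= clid//.
  by apply/andP; split; apply/ltW; near: y; [exact: lt_nbhsr|exact: lt_nbhsl].
Unshelve. all: by end_near. Qed.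

End LipschitzDensity.

(** * Dot product and l1 norm *)

Section DotProduct.
Context {R : realType} {n : nat}.
Implicit Types u v w : 'rV[R]_n.

Lemma dotpDl u v w : dotp (u + v) w = dotp u w + dotp v w.
Proof. by rewrite -big_split; apply: eq_bigr => i _; rewrite mxE mulrDl. Qed.

Lemma dotpC u v : dotp u v = dotp v u.
Proof. by apply: eq_bigr => i _; rewrite mulrC. Qed.

Lemma dotpZl a u v : dotp (a *: u) v = a * dotp u v.
Proof. by rewrite mulr_sumr; apply: eq_bigr => i _; rewrite mxE mulrA. Qed.

Lemma dotpNl u v : dotp (- u) v = - dotp u v.
Proof. by rewrite -scaleN1r dotpZl mulN1r. Qed.

Lemma dotpDr u v w : dotp u (v + w) = dotp u v + dotp u w.
Proof. by rewrite !(dotpC u) dotpDl. Qed.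

Lemma dotpZr a u v : dotp u (a *: v) = a * dotp u v.
Proof. by rewrite !(dotpC u) dotpZl. Qed.

Lemma dotpNr u v : dotp u (- v) = - dotp u v.
Proof. by rewrite !(dotpC u) dotpNl. Qed.

Lemma dotpBr u v w : dotp u (v - w) = dotp u v - dotp u w.
Proof. by rewrite dotpDr dotpNr. Qed.

Lemma dotp_delta u i : dotp u (delta_mx 0 i) = u 0 i.
Proof.
rewrite /dotp (bigD1 i)//= mxE !eqxx mulr1 big1 ?addr0// => j /negPf ji.
by rewrite mxE ji andbF mulr0.
Qed.

(** The l1 norm is dual to a coordinatewise bound and additive under concatenation of rows, so
    estimates in phase space split without square roots. *)
Definition norm1 u : R := \sum_(i < n) `|u 0 i|.

Lemma norm1_ge0 u : 0 <= norm1 u.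
Proof. exact: sumr_ge0. Qed.

Lemma norm10 : norm1 0 = 0.
Proof. by rewrite /norm1 big1// => i _; rewrite mxE normr0. Qed.

Lemma norm1D u v : norm1 (u + v) <= norm1 u + norm1 v.
Proof. by rewrite -big_split; apply: ler_sum => i _; rewrite mxE ler_normD. Qed.

Lemma norm1Z a u : norm1 (a *: u) = `|a| * norm1 u.
Proof. by rewrite mulr_sumr; apply: eq_bigr => i _; rewrite mxE normrM. Qed.

Lemma norm1N u : norm1 (- u) = norm1 u.
Proof. by rewrite -scaleN1r norm1Z normrN1 mul1r. Qed.

Lemma norm1_distC u v : norm1 (u - v) = norm1 (v - u).
Proof. by rewrite -norm1N opprB. Qed.

Lemma le_coord_norm1 u i : `|u 0 i| <= norm1 u.
Proof. by rewrite /norm1 (bigD1 i)//= lerDl sumr_ge0. Qed.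

Lemma norm1_delta i : norm1 (delta_mx 0 i) = 1.
Proof.
rewrite /norm1 (bigD1 i)//= mxE !eqxx normr1 big1 ?addr0// => j /negPf ji.
by rewrite mxE ji andbF normr0.
Qed.

Lemma le_dotp_norm1 u v (L : R) : (forall i, `|u 0 i| <= L) ->
  `|dotp u v| <= L * norm1 v.
Proof.
move=> uL; apply: le_trans (ler_norm_sum _ _ _) _; rewrite mulr_sumr.
by apply: ler_sum => i _; rewrite normrM ler_wpM2r.
Qed.

End DotProduct.

(** * Existence of subgradients of finite convex functions *)

Section Subgradient.
Context {R : realType}.

Definition convexf (V : lmodType R) (G : V -> R) : Prop :=
  forall x y t, 0 <= t <= 1 ->
    G (t *: x + (1 - t) *: y) <= t * G x + (1 - t) * G y.

(** A slope [c] in the direction [e] must separate the backward difference quotients from the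
    forward ones, taken at all points of [W]; convexity of [G] puts every backward quotient below
    every forward one. *)
Lemma hahn_banach_step (V : lmodType R) (G : V -> R) (z e : V) (W : set V)
    (l : V -> R) : convexf G -> W 0 ->
  (forall x y t, W x -> W y -> W (t *: x + (1 - t) *: y)) ->
  (forall x y t, l (t *: x + (1 - t) *: y) = t * l x + (1 - t) * l y) ->
  (forall y, W y -> G z + l y <= G (z + y)) ->
  exists c, forall y s, W y -> G z + l y + c * s <= G (z + y + s *: e).
Proof.
move=> cG W0 cW ll Gl.
have key y y' s s' : W y -> W y' -> 0 < s -> 0 < s' ->
    (G z + l y - G (z + y - s *: e)) / s <=
    (G (z + y' + s' *: e) - G z - l y') / s'.
  move=> Wy Wy' s0 s'0.
  (* These weights satisfy [t * s = (1 - t) * s'], so the [e] components cancel and the convex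
     combination lands in [z + W]. *)
  pose t := s' / (s + s'); have ss : 0 < s + s' by lra.
  have t01 : 0 <= t <= 1.
    apply/andP; split; first by rewrite divr_ge0 ?ltW.
    by rewrite ler_pdivrMr//; lra.
  have t1 : 1 - t = s / (s + s') by rewrite /t; field; lra.
  have := cG (z + y - s *: e) (z + y' + s' *: e) _ t01.
  have -> : t *: (z + y - s *: e) + (1 - t) *: (z + y' + s' *: e) =
            z + (t *: y + (1 - t) *: y').
    have E : t * s = (1 - t) * s' by rewrite t1 /t; field; lra.
    rewrite !(scalerDr, scalerN, scalerA) E.
    rewrite addrACA addNr addr0 addrACA -scalerDl.
    by rewrite subrKC scale1r.
  move=> /(le_trans (Gl _ (cW _ _ t Wy Wy'))); rewrite ll t1 /t => h.
  rewrite ler_pdivrMr// mulrAC ler_pdivlMr//.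
  have := h; rewrite -(ler_pM2r ss).
  set a := G (z + y - _); set b := G (z + y' + _).
  have -> : (G z + (s' / (s + s') * l y + s / (s + s') * l y')) * (s + s') =
    G z * (s + s') + (s' * l y + s * l y') by field; lra.
  have -> : (s' / (s + s') * a + s / (s + s') * b) * (s + s') =
    s' * a + s * b by field; lra.
  lra.
(* [A] collects the backward quotients; its supremum serves as slope, every forward quotient being
   an upper bound. *)
pose A := [set (G z + l p.1 - G (z + p.1 - p.2 *: e)) / p.2 |
  p in [set p : V * R | W p.1 /\ 0 < p.2]].
have A0 : A !=set0 by eexists; exists (0, 1) => //=; split.
have ubA y' s' : W y' -> 0 < s' -> ubound A ((G (z + y' + s' *: e) - G z - l y') / s').
  by move=> Wy' s'0 _ [[y s] [/= Wy s0] <-]; exact: key.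
exists (sup A) => y s Wy; have [s0|s0|->] := ltgtP s 0.
- have : (G z + l y - G (z + y - (- s) *: e)) / (- s) <= sup A.
    apply: ub_le_sup; first by eexists; apply: (ubA 0 1).
    by exists (y, - s) => //=; split=> //; rewrite oppr_gt0.
  by rewrite ler_pdivrMr ?oppr_gt0// scaleNr opprK; lra.
- have : sup A <= (G (z + y + s *: e) - G z - l y) / s.
    by apply: ge_sup => //; exact: ubA.
  by rewrite ler_pdivlMr//; lra.
- by rewrite mulr0 addr0 scale0r addr0; exact: Gl.
Qed.

(** Induction on the dimension: a functional supporting [G] at [z] along the first [k] coordinates
    is extended to the next one by [hahn_banach_step]. *)
Lemma convex_subgradient (n : nat) (G : 'rV[R]_n -> R) (z : 'rV[R]_n) :
  convexf G -> exists xi, forall y, G z + dotp xi (y - z) <= G y.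
Proof.
move=> cG.
suff H k : (k <= n)%N -> exists xi, forall y : 'rV[R]_n,
    (forall i : 'I_n, (k <= i)%N -> y 0 i = 0) -> G z + dotp xi y <= G (z + y).
  have [xi xiP] := H n (leqnn n); exists xi => y.
  have := xiP (y - z); rewrite (addrC z) subrK; apply => i.
  by rewrite leqNgt ltn_ord.
elim: k => [_|k IH kn].
  exists 0 => y y0; have -> : y = 0 by apply/rowP => i; rewrite y0 ?mxE.
  by rewrite -(scale0r 0) dotpZl mul0r scale0r !addr0.
have [xi xiP] := IH (ltnW kn).
pose j := Ordinal kn; pose e : 'rV[R]_n := delta_mx 0 j.
have [|//||//|c cP] := @hahn_banach_step _ G z e
  [set y | forall i : 'I_n, (k <= i)%N -> y 0 i = 0] (dotp xi) cG.
- by move=> i _ /=; rewrite mxE.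
- by move=> x y t /= x0 y0 i ki; rewrite !mxE x0// y0// !mulr0 addr0.
- by move=> x y t; rewrite dotpDr !dotpZr.
(* This replaces the [j]-th coordinate of [xi] by [c] and keeps the others. *)
exists (xi + (c - xi 0 j) *: e) => y yk.
have := cP (y - y 0 j *: e) (y 0 j).
rewrite addrA subrK dotpBr dotpDl !dotpZl dotpZr dotp_delta (dotpC e) dotp_delta.
move=> h; apply: le_trans (h _); first lra.
move=> i ki; rewrite !mxE /=; have [->|ij] := eqVneq i j.
  by rewrite /= mulr1 subrr.
rewrite /= mulr0 subr0 yk// ltn_neqAle ki andbT eq_sym.
by apply: contra ij => /eqP ij; apply/eqP/val_inj.
Qed.

End Subgradient.

(** * Limits along an ultrafilter *)

Section UltrafilterLimit.
Context {R : realType}.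

(** Compactness yields a cluster point, and an ultrafilter converges to its cluster points. A single
    filter thus serves all times at once, with no extraction of subsequences. *)
Lemma ultra_bounded_cvg {I : Type} {U : set_system I} (UU : UltraFilter U)
    (a : I -> R) (C : R) :
  (forall m, `|a m| <= C) -> cvg (a m @[m --> U]).
Proof.
move=> aC; have PU : ProperFilter U by exact: ultra_proper.
have [|p [_ clp]] := @segment_compact R (- C) C (a m @[m --> U]) _.
  apply: (@filterS _ U _ setT) => [m _|]; last exact: filterT.
  by rewrite /= in_itv/= -ler_norml.
apply/cvg_ex; exists p => B Bp.
have [//|UB] := in_ultra_setVsetC (a @^-1` B) UU.
by have [q [? ?]] := clp (~` B) B UB Bp.
Qed.

Lemma cvg_sumr {I : Type} {U : set_system I} {FU : Filter U} (n : nat)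
    (f : 'I_n -> I -> R) (l : 'I_n -> R) :
  (forall i, f i m @[m --> U] --> l i) ->
  \sum_(i < n) f i m @[m --> U] --> \sum_(i < n) l i.
Proof.
move=> fl; elim: (index_enum _) => [|i s IH].
  rewrite big_nil; under eq_fun do rewrite big_nil.
  exact: cvg_cst.
rewrite big_cons; under eq_fun do rewrite big_cons.
by apply: cvgD.
Qed.

End UltrafilterLimit.

(** * The explicit Euler scheme and its limit curve *)

Section Euler.
Context {R : realType} {n : nat}.
Local Notation V := 'rV[R]_n.

Lemma rowBE (u v : V) i : (u - v) 0 i = u 0 i - v 0 i.
Proof. by rewrite !mxE. Qed.

Lemma dotp_mulmx (A : 'M[R]_n) (u v : V) : dotp (u *m A) v = dotp u (v *m A^T).
Proof.
have E (a b : V) : dotp a b = (a *m b^T) 0 0.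
  by rewrite mxE; apply: eq_bigr => i _; rewrite mxE.
by rewrite !E trmx_mul trmxK mulmxA.
Qed.

Definition euler (f : V -> V) (d : R) (x0 : V) (k : nat) : V :=
  iter k (fun u => u + d *: f u) x0.

Lemma euler_dist (f : V -> V) (d C : R) (x0 : V) (j m : nat) : 0 <= d ->
  (forall u, norm1 (f u) <= C) ->
  norm1 (euler f d x0 (m + j) - euler f d x0 j) <= C * (m%:R * d).
Proof.
move=> d0 fC; elim: m => [|m IH]; first by rewrite subrr norm10 mul0r mulr0.
rewrite addSn /= addrAC; apply: le_trans (norm1D _ _) _.
rewrite norm1Z ger0_norm// -natr1 mulrDl mulrDr lerD//.
by rewrite mul1r mulrC ler_wpM2r.
Qed.

(* Averages the subgradient inequality over [m] consecutive steps. *)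
Lemma euler_subgradient (G : V -> R) (xi : V -> V) (A : 'M[R]_n) (d L E : R)
    (x0 y z : V) (j m : nat) :
  A *m A = - 1%:M -> 0 <= d -> 0 <= L ->
  (forall u w, G u + dotp (xi u) (w - u) <= G w) ->
  (forall u i, `|xi u 0 i| <= L) ->
  (forall u w, `|G u - G w| <= L * norm1 (u - w)) ->
  let X := euler (fun u => xi u *m A) d x0 in
  (forall i, (i < m)%N -> norm1 (X (i + j)%N - z) <= E) ->
  dotp (- (X (m + j)%N - X j) *m A) (y - z) <=
    m%:R * d * (G y - G z + 2 * L * E).
Proof.
move=> AA d0 L0 sub xiL GL X; elim: m => [_|m IH XE].
  by rewrite subrr oppr0 mul0mx -[0](scale0r 0) dotpZl !mul0r.
set u := X (m + j)%N.
(* Since [A *m A = - 1%:M], multiplying the increment [d *: (xi u *m A)] by [- A] gives back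
   [d *: xi u]. *)
have -> : - (X (m.+1 + j)%N - X j) *m A = (- (u - X j) *m A) + d *: xi u.
  rewrite (_ : X (m.+1 + j)%N = u + d *: (xi u *m A))//.
  rewrite addrAC opprD mulmxDl; congr (_ + _).
  by rewrite mulNmx -scalemxAl -mulmxA AA mulmxN mulmx1 scalerN opprK.
rewrite dotpDl dotpZl -natr1 (mulrDl _ 1 d) mul1r (mulrDl _ d) lerD//.
  by apply: IH => i im; apply: XE; exact: ltnW.
rewrite ler_wpM2l//.
(* The first part is controlled by the subgradient inequality at [u]. The second costs [L * E], and
   so does replacing [G u] by [G z]; hence the constant [2 * L * E]. *)
have -> : y - z = (y - u) + (u - z) by rewrite addrA subrK.
rewrite dotpDr.
have h1 := sub u y.
have h2 : dotp (xi u) (u - z) <= L * E.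
  apply: le_trans (ler_norm _) _; apply: le_trans (le_dotp_norm1 _ (xiL u)) _.
  by rewrite ler_wpM2l// XE.
have h3 : G z - G u <= L * E.
  apply: le_trans (ler_norm _) _; apply: le_trans (GL _ _) _.
  by rewrite ler_wpM2l// norm1_distC XE.
lra.
Qed.

(** The subgradient inequality is tested at [z] plus and minus a unit vector. *)
Lemma lipschitz_subgradient (G : V -> R) (L : R) (z xi : V) (i : 'I_n) :
  (forall u w, `|G u - G w| <= L * norm1 (u - w)) ->
  (forall y, G z + dotp xi (y - z) <= G y) -> `|xi 0 i| <= L.
Proof.
move=> GL xiP; rewrite ler_norml.
have h1 := xiP (z + delta_mx 0 i); have h2 := xiP (z - delta_mx 0 i).
have h3 := GL (z + delta_mx 0 i) z; have h4 := GL (z - delta_mx 0 i) z.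
have zD (e : V) : z + e - z = e by rewrite addrAC subrr add0r.
move: h1 h2 h3 h4; rewrite !zD norm1N norm1_delta mulr1 dotpNr !dotp_delta.
move=> h1 h2.
by rewrite !ler_norml => /andP[? ?] /andP[? ?]; apply/andP; split; lra.
Qed.

(** The Euler curves satisfy uniform Lipschitz bounds up to one step, and the averaged inequality,
    centred at the limit point [x t], converges term by term. Its error [2 * L * (C * h)] survives
    division by [h] but vanishes as [h] tends to 0, which is what differentiation of [x]
    requires. *)
Lemma euler_limit (G : V -> R) (A : 'M[R]_n) (L : R) (x0 : V) :
  A *m A = - 1%:M -> (forall u, norm1 (u *m A) = norm1 u) -> 0 <= L ->
  convexf G -> (forall u w, `|G u - G w| <= L * norm1 (u - w)) ->
  exists x : R -> V, exists C : R,
  [/\ x 0 = x0, 0 <= C,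
      forall s t, 0 <= s -> 0 <= t -> norm1 (x s - x t) <= C * `|s - t| &
      forall t h y, 0 <= t -> 0 < h ->
        dotp (- (x (t + h) - x t) *m A) (y - x t) <=
        h * (G y - G (x t) + 2 * L * (C * h))].
Proof.
move=> AA nA L0 cG GL.
have /choice[xi xiP] z := convex_subgradient z cG.
have xiL u i : `|xi u 0 i| <= L by exact: lipschitz_subgradient GL (xiP u).
(* A subgradient has [n] coordinates of size at most [L], and [A] preserves the l1 norm. *)
pose C : R := n%:R * L; pose f u := xi u *m A.
have C0 : 0 <= C by rewrite mulr_ge0.
have fC u : norm1 (f u) <= C.
  rewrite nA /norm1 /C mulr_natl -[n in leRHS]card_ord -sumr_const.
  exact: ler_sum.
pose M m : R := m.+1%:R; have M0 m : 0 < M m by rewrite ltr0n.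
(* For [t >= 0] this is the index of the last Euler node at or before [t], the step size being
   [(M m)^-1]. *)
pose k t m := Num.truncn (t * M m).
have kle t m : 0 <= t -> (k t m)%:R / M m <= t.
  by move=> t0; rewrite ler_pdivrMr// truncn_le mulr_ge0// ltW.
have kgt t m : t - (M m)^-1 <= (k t m)%:R / M m.
  rewrite lerBlDr -{2}[(M m)^-1]mul1r -mulrDl natr1 ler_pdivlMr//.
  exact/ltW/truncnS_gt.
have kmono s t m : s <= t -> (k s m <= k t m)%N.
  by move=> st; apply: le_truncn; rewrite ler_wpM2r// ltW.
pose X m := euler f (M m)^-1 x0.
pose xm m t := X m (k t m).
(* The total length of the steps between the two nodes is [t - s] up to one step. *)
have kdiff s t m : 0 <= s -> s <= t ->
    t - s - (M m)^-1 <= (k t m - k s m)%:R / M m <= t - s + (M m)^-1.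
  move=> s0 st; rewrite natrB ?kmono// mulrBl.
  have := kle s m s0; have := kle t m (le_trans s0 st).
  have := kgt s m; have := kgt t m.
  set a := (k t m)%:R / _; set b := (k s m)%:R / _; set c := (M m)^-1.
  by move=> *; apply/andP; split; lra.
have xmdist s t m : 0 <= s -> s <= t ->
    norm1 (xm m t - xm m s) <= C * (t - s + (M m)^-1).
  move=> s0 st; rewrite /xm -(subnK (kmono s t m st)).
  apply: le_trans (euler_dist _ _ _ _ fC) _; first by rewrite invr_ge0 ltW.
  by rewrite ler_wpM2l//; have /andP[] := kdiff s t m s0 st.
have xm0 m : xm m 0 = x0 by rewrite /xm /k mul0r truncn0.
have [U [UU ooU]] := ultraFilterLemma eventually_filter.
have PU : ProperFilter U by exact: ultra_proper.
have M_0 : (M m)^-1 @[m --> U] --> (0 : R).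
  by apply: cvg_trans (@cvg_harmonic R); apply: cvg_app.
have cvx t i : 0 <= t -> cvg (xm m t 0 i @[m --> U]).
  (* The summand 1 absorbs the step size [(M m)^-1], which is at most 1. *)
  move=> t0; apply: (@ultra_bounded_cvg _ _ _ UU _ (norm1 x0 + C * (t + 1))) => m.
  apply: le_trans (le_coord_norm1 _ _) _.
  rewrite -[xm m t](subrK x0) addrC; apply: le_trans (norm1D _ _) _.
  rewrite lerD2l -(xm0 m); apply: le_trans (xmdist _ _ _ _ t0) _ => //.
  by rewrite ler_wpM2l// subr0 lerD2l invf_le1// ler1n.
pose x t : V := \row_i lim (xm m t 0 i @[m --> U]).
have xmx t i : 0 <= t -> xm m t 0 i @[m --> U] --> x t 0 i.
  by move=> t0; rewrite mxE; exact: cvx.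
have xcst (t : R) (z : V) : 0 <= t -> norm1 (xm m t - z) @[m --> U] --> norm1 (x t - z).
  move=> t0; apply: cvg_sumr => i; apply: cvg_norm; rewrite rowBE.
  under eq_fun do rewrite rowBE.
  by apply: cvgB; [exact: xmx|exact: cvg_cst].
have xmd s t : 0 <= s -> 0 <= t ->
    norm1 (xm m t - xm m s) @[m --> U] --> norm1 (x t - x s).
  move=> s0 t0; apply: cvg_sumr => i; apply: cvg_norm; rewrite rowBE.
  under eq_fun do rewrite rowBE.
  by apply: cvgB; exact: xmx.
exists x, C; split => //.
- by apply/rowP => i; rewrite mxE; under eq_fun do rewrite xm0; apply: lim_cst.
- move=> s t; wlog st : s t / s <= t.
    by move=> h s0 t0; case: (leP s t) => [|/ltW] st; [|rewrite norm1_distC distrC]; exact: h.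
  move=> s0 t0; rewrite norm1_distC distrC ger0_norm ?subr_ge0//.
  apply: (@ler_cvg_to _ U _ _ _ (fun m => C * (t - s + (M m)^-1)) _ _ (xmd s t s0 t0)).
    rewrite -{2}[t - s]addr0; apply: cvgMr; apply: cvgD => //; exact: cvg_cst.
  by apply: filterE => m; exact: xmdist.
- move=> t h y t0 h0; have th0 : 0 <= t + h by rewrite addr_ge0// ltW.
  rewrite dotp_mulmx.
  pose q m : R := (k (t + h) m - k t m)%:R / M m.
  have qh : q m @[m --> U] --> h.
    apply: (@squeeze_cvgr _ _ _ _ (fun m => h - (M m)^-1) (fun m => h + (M m)^-1)).
    + apply: filterE => m; have := kdiff t (t + h) m t0.
      have -> : t + h - t = h by rewrite addrAC subrr add0r.
      by rewrite lerDl (ltW h0); exact.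
    + by rewrite -{2}[h]subr0; apply: cvgB => //; exact: cvg_cst.
    + by rewrite -{2}[h]addr0; apply: cvgD => //; exact: cvg_cst.
  (* This bounds the distance from [x t] to every node of the averaged steps: the error of the curve
     at time [t], plus the drift of the later nodes. *)
  pose E m := norm1 (xm m t - x t) + C * q m.
  have Eh : E m @[m --> U] --> C * h.
    rewrite -[C * h]add0r; apply: cvgD; last exact: cvgMr.
    have -> : (0 : R) = norm1 (x t - x t) by rewrite subrr norm10.
    exact: xcst.
  apply: (@ler_cvg_to _ U _ _
    (fun m => dotp (- (xm m (t + h) - xm m t)) ((y - x t) *m A^T))
    (fun m => q m * (G y - G (x t) + 2 * L * E m))).
  + apply: cvg_sumr => i; apply: cvgMl.
    rewrite opprB rowBE; under eq_fun do rewrite opprB rowBE.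
    by apply: cvgB; exact: xmx.
  + by apply: cvgM => //; apply: cvgD; [exact: cvg_cst|apply: cvgMr].
  + apply: filterE => m; rewrite -dotp_mulmx /xm.
    have ktt : (k t m <= k (t + h)%R m)%N by apply: kmono; rewrite lerDl ltW.
    rewrite -{1}(subnK ktt) /q.
    apply: euler_subgradient => //; first by rewrite invr_ge0 ltW.
    move=> i ik; rewrite -/f -/(X m).
    have -> : X m (i + k t m)%N - x t =
        (X m (k t m) - x t) + (X m (i + k t m)%N - X m (k t m)).
      by rewrite [RHS]addrC addrA subrK.
    apply: le_trans (norm1D _ _) _; rewrite lerD2l.
    apply: le_trans (euler_dist _ _ _ _ fC) _; first by rewrite invr_ge0 ltW.
    by rewrite ler_wpM2l// ler_wpM2r ?invr_ge0 ?(ltW (M0 m))// ler_nat ltnW.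
Qed.

End Euler.

(** * The flow of a Lipschitz convex Hamiltonian *)

Section LipschitzHamiltonian.
Context {R : realType} {n : nat}.
Local Notation mu := (@lebesgue_measure R).
Local Notation V := 'rV[R]_n.

Lemma is_derive_quotient_dotp (x : R -> V) (t : R) (v w : V) :
  (forall i, is_derive t 1 (fun s => x s 0 i) (v 0 i)) ->
  h^-1 * dotp (x (t + h) - x t) w @[h --> 0^'] --> dotp v w.
Proof.
move=> dx; under eq_fun do rewrite mulr_sumr.
apply: cvg_sumr => i; under eq_fun do rewrite mulrA.
apply: cvgMl; under eq_fun do rewrite rowBE.
exact: is_derive_quotient_cvg.
Qed.

(** Both [x] and [G \o x] are Lipschitz, hence differentiable almost everywhere. Dividing the Euler
    inequality by [h] makes [- v t *m A] a subgradient; it is orthogonal to [v t], so [G \o x] has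
    derivative zero almost everywhere and is constant. *)
Lemma lipschitz_hamiltonian_flow (G : V -> R) (A : 'M[R]_n) (L T : R) (x0 : V) :
  0 < T -> A *m A = - 1%:M -> (forall u, norm1 (u *m A) = norm1 u) ->
  (forall u : V, dotp (u *m A) u = 0) -> 0 <= L ->
  convexf G -> (forall u w, `|G u - G w| <= L * norm1 (u - w)) ->
  exists x : R -> V, exists v : R -> V, exists C : R,
  [/\ x 0 = x0 /\ 0 <= C,
      forall s t, 0 <= s -> 0 <= t -> norm1 (x s - x t) <= C * `|s - t|,
      forall i, measurable_fun setT (fun t => v t 0 i) /\
        exists K, forall t, `|v t 0 i| <= K,
      {ae mu, forall t, 0 < t < T ->
        (forall i, is_derive t 1 (fun s => x s 0 i) (v t 0 i)) /\
        forall y, G (x t) + dotp (- v t *m A) (y - x t) <= G y} &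
      forall t, 0 <= t <= T -> G (x t) = G x0].
Proof.
move=> T0 AA nA sA L0 cG GL.
have [x [C [x0E C0 xL xE]]] := euler_limit x0 AA nA L0 cG GL.
have xiL (i : 'I_n) : exists vi : R -> R, exists K,
   [/\ measurable_fun setT vi, forall t, `|vi t| <= K &
      {ae mu, forall t, 0 < t < T -> is_derive t 1 (fun s => x s 0 i) (vi t)}].
  have [|vi [K [? ? _ ?]]] := @lipschitz_density R (fun s => x s 0 i) C 0 T T0 C0.
    move=> s t /andP[s0 _] /andP[t0 _]; apply: le_trans (xL s t s0 t0).
    by rewrite -rowBE le_coord_norm1.
  by exists vi, K.
have /choice[v /choice[K vP]] := xiL.
have LC0 : 0 <= L * C by rewrite mulr_ge0.
have gL s t : 0 <= s <= T -> 0 <= t <= T ->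
    `|G (x s) - G (x t)| <= L * C * `|s - t|.
  move=> /andP[s0 _] /andP[t0 _]; apply: le_trans (GL _ _) _.
  by rewrite -mulrA ler_wpM2l// xL.
have [w [Kw [mw wK wI dw]]] := lipschitz_density T0 LC0 gL.
pose V0 t : V := \row_i v i t.
have aex : {ae mu, forall t, 0 < t < T ->
    (forall i, is_derive t 1 (fun s => x s 0 i) (V0 t 0 i)) /\
    forall y, G (x t) + dotp (- V0 t *m A) (y - x t) <= G y}.
  have /filter_forall : forall i, \forall t \ae mu,
      0 < t < T -> is_derive t 1 (fun s => x s 0 i) (v i t).
    by move=> i; have [] := vP i.
  apply: filterS => t dx t0T; have dxt i : is_derive t 1 (fun s => x s 0 i) (V0 t 0 i).
    by rewrite mxE; exact: dx.
  split=> // y; rewrite mulNmx dotpNl dotp_mulmx -lerBrDl.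
  (* Right-hand quotients are used because the Euler inequality concerns [h > 0]. *)
  have dq := cvg_dnbhs_at_right (is_derive_quotient_dotp (w := (y - x t) *m A^T) dxt).
  apply: (@ler_cvg_to _ _ _ _ _ (fun h => G y - G (x t) + 2 * L * (C * h)) _ _ (cvgN dq)).
    have : 2 * L * (C * h) @[h --> (0 : R)^'+] --> 2 * L * (C * 0).
      by apply: cvg_at_right_filter; apply: cvgMr; apply: cvgMr; exact: cvg_id.
    rewrite !mulr0 => h0; rewrite -[X in _ --> X]addr0.
    by apply: cvgD h0; exact: cvg_cst.
  near=> h; have h0 : 0 < h by near: h; exact: nbhs_right_gt.
  have /andP[t0 _] := t0T.
  have := xE t h y (ltW t0) h0.
  rewrite mulNmx dotpNl dotp_mulmx -ler_pdivrMl// mulrN; exact: le_trans.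
have aew : {ae mu, forall t, 0 < t < T -> w t = 0}.
  apply: (@filterS2 _ _ (ae_filter_ringOfSetsType mu) _ _ _ _ aex dw).
  move=> t + + t0T => /(_ t0T)[dx subt] /(_ t0T) /is_derive_quotient_cvg dg.
  have dq := is_derive_quotient_dotp (w := - V0 t *m A) dx.
  rewrite dotpC mulNmx dotpNl sA oppr0 in dq.
  (* This holds for [h] of either sign, and its left side divided by [h] tends to 0: negative [h]
     gives [w t <= 0], positive [h] gives [0 <= w t]. *)
  have quot h : dotp (x (t + h) - x t) (- (V0 t *m A)) <= G (x (t + h)) - G (x t).
    by rewrite dotpC -mulNmx lerBrDl; exact: subt.
  apply/le_anti/andP; split.
  - apply: (ler_cvg_to (cvg_dnbhs_at_left dg) (cvg_dnbhs_at_left dq)).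
    near=> h; have h0 : h < 0 by near: h; exact: nbhs_left_lt.
    by rewrite ler_nM2l ?invr_lt0.
  - apply: (ler_cvg_to (cvg_dnbhs_at_right dq) (cvg_dnbhs_at_right dg)).
    near=> h; have h0 : 0 < h by near: h; exact: nbhs_right_gt.
    by rewrite ler_pM2l ?invr_gt0.
exists x, V0, C; split => //.
- move=> i; have [mv vK _] := vP i.
  rewrite (_ : (fun t => V0 t 0 i) = v i); last by apply/funext => t; rewrite mxE.
  by split => //; exists (K i) => t; rewrite mxE.
- move=> t /andP[t0 tT]; apply/eqP; rewrite -subr_eq0 -x0E -(wI 0 t)//.
  apply/eqP; rewrite (_ : \int[mu]_(s in `]0, t[) w s = \int[mu]_(s in `]0, t[) 0).
    by rewrite Rintegral_oo_cst// mul0r.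
  congr fine; apply: ae_eq_integral => //.
  + by apply/measurable_EFinP; exact: measurable_funTS.
  + apply: (@filterS _ _ (ae_filter_ringOfSetsType mu) _ _ _ aew) => s h; rewrite /= in_itv/= => /andP[s0 st]; rewrite h// s0.
    exact: lt_le_trans tT.
Unshelve. all: by end_near. Qed.

End LipschitzHamiltonian.

(** * Confinement of the flow by coercivity *)

Section CoerciveHamiltonian.
Context {R : realType} {n : nat}.
Local Notation mu := (@lebesgue_measure R).
Local Notation V := 'rV[R]_n.

(* [G] is the supremum of supporting affine functions at the points of the ball. *)
Lemma lipschitz_truncation (G0 : V -> R) (rho a B : R) :
  convexf G0 -> 0 <= rho -> (forall u, - a <= G0 u) ->
  (forall u, norm1 u <= rho + 1 -> G0 u <= B) ->
  exists G : V -> R, exists L : R,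
  [/\ 0 <= L, convexf G, forall u w, `|G u - G w| <= L * norm1 (u - w),
      forall u, G u <= G0 u & forall u, norm1 u <= rho -> G u = G0 u].
Proof.
move=> cG rho0 aG GB.
have /choice[xi xiP] z := convex_subgradient z cG.
(* A unit step from the ball of radius [rho] starts at a value at least [- a] and ends at one at
   most [B], so [L] bounds the slopes. *)
pose L := B + a.
have L0 : 0 <= L.
  by have := aG 0; have := GB 0; rewrite norm10 /L => /(_ ltac:(lra)); lra.
have xiL y i : norm1 y <= rho -> `|xi y 0 i| <= L.
  move=> yr; have le e : norm1 e = 1 -> dotp (xi y) e <= L.
    move=> e1; have := xiP y (y + e); have := aG y.
    have : G0 (y + e) <= B.
      by apply: GB; apply: le_trans (norm1D _ _) _; rewrite e1 lerD2r.
    have -> : y + e - y = e by rewrite addrAC subrr add0r.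
    rewrite /L; lra.
  rewrite ler_norml -dotp_delta le ?norm1_delta// andbT lerNl -dotpNr le//.
  by rewrite norm1N norm1_delta.
pose S u := [set G0 y + dotp (xi y) (u - y) | y in [set y : V | norm1 y <= rho]].
have S0 u : S u !=set0 by eexists; exists 0 => //=; rewrite norm10.
have Sub u : ubound (S u) (G0 u) by move=> _ [y _ <-]; exact: xiP.
pose G u := sup (S u).
have leG u y : norm1 y <= rho -> G0 y + dotp (xi y) (u - y) <= G u.
  by move=> yr; apply: ub_le_sup; [exists (G0 u)|exists y].
have Gle u c : (forall y, norm1 y <= rho -> G0 y + dotp (xi y) (u - y) <= c) ->
    G u <= c.
  by move=> h; apply: ge_sup => // _ [y yr <-]; exact: h.
exists G, L; split => //.
- move=> x y t /andP[t0 t1]; apply: Gle => z zr.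
  have -> : t *: x + (1 - t) *: y - z = t *: (x - z) + (1 - t) *: (y - z).
    rewrite !scalerBr addrACA -opprD -scalerDl.
    by rewrite [t + (1 - t)]addrC subrK scale1r.
  rewrite dotpDr !dotpZr.
  set P := dotp _ (x - z); set Q := dotp _ (y - z).
  have -> : G0 z + (t * P + (1 - t) * Q) = t * (G0 z + P) + (1 - t) * (G0 z + Q).
    by ring.
  by rewrite lerD// ler_wpM2l ?subr_ge0// leG.
- have le u w : G u - G w <= L * norm1 (u - w).
    rewrite lerBlDr; apply: Gle => z zr.
    have := leG w z zr.
    have -> : u - z = (u - w) + (w - z) by rewrite addrA subrK.
    rewrite (dotpDr _ (u - w)); have : dotp (xi z) (u - w) <= L * norm1 (u - w).
      apply: le_trans (ler_norm _) (le_dotp_norm1 _ _) => i; exact: xiL.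
    lra.
  by move=> u w; rewrite ler_norml le andbT lerNl opprB norm1_distC.
- by move=> u; apply: Gle => z zr; exact: xiP.
- move=> u ur; apply/le_anti/andP; split.
    by apply: Gle => z zr; exact: xiP.
  by have := leG u u ur; rewrite subrr -(scale0r 0) dotpZr mul0r addr0.
Qed.

(** The flow of the truncation [G] conserves [G], while on the sphere of radius [rho] one has
    [G = G0 > G0 x0], so the curve stays inside. Where [G = G0], a subgradient of the minorant [G]
    is one of [G0]. *)
Lemma coercive_hamiltonian_flow (G0 : V -> R) (A : 'M[R]_n) (a rho B T : R)
    (x0 : V) :
  0 < T -> A *m A = - 1%:M -> (forall u, norm1 (u *m A) = norm1 u) ->
  (forall u : V, dotp (u *m A) u = 0) ->
  convexf G0 -> (forall u, - a <= G0 u) ->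
  (forall u, norm1 u <= rho + 1 -> G0 u <= B) ->
  (forall u, rho <= norm1 u -> G0 x0 < G0 u) ->
  exists x : R -> V, exists v : R -> V, exists C : R,
  [/\ x 0 = x0 /\ 0 <= C,
      forall s t, 0 <= s -> 0 <= t -> norm1 (x s - x t) <= C * `|s - t|,
      forall i, measurable_fun setT (fun t => v t 0 i) /\
        exists K, forall t, `|v t 0 i| <= K &
      {ae mu, forall t, 0 < t < T ->
        (forall i, is_derive t 1 (fun s => x s 0 i) (v t 0 i)) /\
        forall y, G0 (x t) + dotp (- v t *m A) (y - x t) <= G0 y}].
Proof.
move=> T0 AA nA sA cG0 aG0 G0B G0x0.
have x0rho : norm1 x0 < rho by rewrite ltNge; apply/negP => /G0x0; rewrite ltxx.
have rho0 : 0 <= rho by apply: le_trans (norm1_ge0 x0) (ltW _).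
have [G [L [L0 cG GL GG0 GE]]] := lipschitz_truncation cG0 rho0 aG0 G0B.
have [x [v [C [[x0E C0] xL mv aev xG]]]] :=
  lipschitz_hamiltonian_flow x0 T0 AA nA sA L0 cG GL.
exists x, v, C; split => //.
have xrho t : 0 <= t <= T -> norm1 (x t) <= rho.
  move=> /andP[t0 tT]; rewrite leNgt; apply/negP => xt.
  (* Freezing the curve at negative times makes its norm Lipschitz on the whole line; the
     intermediate value theorem then finds a time at which the norm is exactly [rho]. *)
  pose g s := norm1 (x (Num.max 0 s)).
  have gL s s' : `|g s - g s'| <= C * `|s - s'|.
    have h (u w : V) : norm1 u - norm1 w <= norm1 (u - w).
      by rewrite lerBlDr -{1}(subrK w u) norm1D.
    apply: (@le_trans _ _ (C * `|Num.max 0 s - Num.max 0 s'|)).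
      apply: le_trans (xL _ _ _ _); rewrite ?le_max ?lexx//.
      by rewrite ler_norml h andbT lerNl opprB norm1_distC h.
    rewrite ler_wpM2l//.
    case: (leP 0 s); case: (leP 0 s') => hs hs'; rewrite ?subrr ?normr0//.
    - by rewrite subr0 ger0_norm// ger0_norm; lra.
    - by rewrite sub0r normrN ger0_norm// ltr0_norm; lra.
  have [|s sin gs] := @IVT R g 0 t rho t0 (continuous_subspaceT (lipschitz_continuous gL)).
    rewrite /g maxxx x0E (max_idPr t0) ge_min (ltW x0rho)/= le_max (ltW xt) orbT//.
  move: sin; rewrite in_itv/= => /andP[s0 st].
  have xs : norm1 (x s) = rho by rewrite -gs /g (max_idPr s0).
  have := G0x0 (x s); rewrite xs lexx => /(_ isT).
  rewrite -(GE (x s)) ?xs// xG ?s0 ?(le_trans st)//.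
  by rewrite ltNge GG0.
apply: (@filterS _ _ (ae_filter_ringOfSetsType mu) _ _ _ aev) => t h t0T.
have [dx xy] := h t0T; split=> // y; apply: le_trans (GG0 y).
rewrite -GE; first exact: xy.
by apply: xrho; move: t0T => /andP[t0 tT]; rewrite !ltW.
Qed.

End CoerciveHamiltonian.

(** * Lipschitz curves as Sobolev functions *)

Section SobolevLipschitz.
Import HBNNSimple.
Context {R : realType}.
Local Notation mu := (@lebesgue_measure R).

(* [f] may fail to be measurable, so the proof works with the simple functions below it. *)
Lemma ge0_ae0_integral (D : set R) (f : R -> \bar R) : measurable D ->
  (forall t, D t -> (0 <= f t)%E) -> {ae mu, forall t, D t -> f t = 0%E} ->
  (\int[mu]_(t in D) f t = 0)%E.
Proof.
move=> mD f0 aef; apply/eqP; rewrite eq_le integral_ge0// andbT.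
rewrite ge0_integralE//; apply: ge_ereal_sup => _ [h /= hf <-].
rewrite -integralT_nnsfun (@ae_eq_integral _ _ _ _ _ (cst 0%E))//; last first.
  apply: (@filterS _ _ (ae_filter_ringOfSetsType mu) _ _ _ aef) => t ft _ /=.
  have h0 : (0 <= (h t)%:E)%E by rewrite lee_fin.
  apply/eqP; rewrite eq_le h0 andbT; apply: le_trans (hf t) _.
  by rewrite patchE; case: ifPn => // /set_mem/ft ->.
- by apply/measurable_EFinP; exact: measurable_funP.
- by rewrite integral0.
Qed.

Lemma lipschitz_within_continuous (V : normedModType R) (f : R -> V) (C T : R) :
  0 <= C -> (forall s t, 0 <= s -> 0 <= t -> `|f s - f t| <= C * `|s - t|) ->
  {within `[0, T], continuous f}.
Proof.
move=> C0 fL; pose g s := f (Num.max 0 s).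
apply: (@subspace_eq_continuous _ _ _ g).
  by move=> s /set_mem; rewrite /= in_itv/= /g => /andP[s0 _]; rewrite (max_idPr s0).
apply/continuous_subspaceT/(@lipschitz_continuous _ _ _ C) => s t.
apply: (@le_trans _ _ (C * `|Num.max 0 s - Num.max 0 t|)).
  by apply: fL; rewrite le_max lexx.
rewrite ler_wpM2l//.
case: (leP 0 s); case: (leP 0 t) => hs hs'; rewrite ?subrr ?normr0//.
- by rewrite subr0 ger0_norm// ger0_norm; lra.
- by rewrite sub0r normrN ger0_norm// ltr0_norm; lra.
Qed.

(** The support lies in the open interval, so [phi] vanishes at both ends; its continuous derivative
    is bounded on [[0, T]], and the mean value theorem turns this into a Lipschitz bound. *)
Lemma test_function_lipschitz (T : R) (phi : R -> R) : 0 < T ->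
  test_function T phi ->
  [/\ phi 0 = 0, phi T = 0,
      forall t : R, is_derive t 1 phi (derive1 phi t),
      continuous (derive1 phi) &
      exists M : R, 0 <= M /\ (forall t, t \in `[0, T] -> `|derive1 phi t| <= M) /\
        forall s t, 0 <= s <= T -> 0 <= t <= T ->
          `|phi s - phi t| <= M * `|s - t|].
Proof.
move=> T0 [dphi _ supp].
have phi0 t : ~ `]0, T[%classic t -> phi t = 0.
  move=> nt; apply/eqP/negPn/negP => pt; apply: nt; apply: supp.
  exact: subset_closure.
have d1 (t : R) : is_derive t 1 phi (derive1 phi t).
  by rewrite derive1E; apply/derivableP; exact: (dphi 0%N).
have c1 : continuous (derive1 phi).
  move=> t; apply/differentiable_continuous/derivable1_diffP.
  by rewrite -derive1n1; exact: dphi.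
split => //; [| |].
- by apply: phi0; rewrite /= in_itv/= ltxx.
- by apply: phi0; rewrite /= in_itv/= ltxx andbF.
have /compact_bounded [M [_ MP]] : compact (derive1 phi @` `[0, T]).
  by apply: continuous_compact; [exact: continuous_subspaceT|exact: segment_compact].
exists (`|M| + 1); split; first by rewrite addr_ge0.
have M1 t : t \in `[0, T] -> `|derive1 phi t| <= `|M| + 1.
  move=> tT; apply: (MP (`|M| + 1)); last by exists t.
  by rewrite (le_lt_trans (ler_norm M))// ltrDl.
split => // s t; wlog st : s t / s <= t.
  by move=> h; case: (leP s t) => [|/ltW] st; [|rewrite distrC (distrC s)] => ? ?; exact: h.
move=> /andP[s0 sT] /andP[t0 tT].
have [|c cst E] := @MVT_segment R phi (derive1 phi) s t st (fun x _ => d1 x).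
  apply: continuous_subspaceT => x.
  by apply/differentiable_continuous/derivable1_diffP; exact: (dphi 0%N).
rewrite distrC E normrM (distrC s) ler_wpM2r// M1//.
move: cst; rewrite !in_itv/= => /andP[sc ct].
by rewrite (le_trans s0 sc) (le_trans ct tT).
Qed.

(** The product of [f] and [phi] is Lipschitz and vanishes at 0 and [T], so its density integrates
    to 0; the product rule identifies this density almost everywhere. *)
Lemma lipschitz_weak_derivative (T C K : R) (f v phi : R -> R) : 0 < T -> 0 <= C ->
  (forall s t, 0 <= s -> 0 <= t -> `|f s - f t| <= C * `|s - t|) ->
  measurable_fun setT v -> (forall t, `|v t| <= K) ->
  {ae mu, forall t, 0 < t < T -> is_derive t 1 f (v t)} ->
  test_function T phi ->
  \int[mu]_(t in `]0, T[) (f t * derive1 phi t) =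
  - \int[mu]_(t in `]0, T[) (v t * phi t).
Proof.
move=> T0 C0 fL mv vK dv tphi.
have [phi0 phiT dphi cphi [M [M0 [dphiM phiL]]]] := test_function_lipschitz T0 tphi.
pose B := `|f 0| + C * T.
have B0 : 0 <= B by rewrite addr_ge0// mulr_ge0// ltW.
have fB t : 0 <= t <= T -> `|f t| <= B.
  move=> /andP[t0 tT]; rewrite -[f t](subrK (f 0)) addrC.
  apply: le_trans (ler_normD _ _) _; rewrite lerD2l.
  apply: le_trans (fL _ _ t0 (lexx 0)) _.
  by rewrite subr0 ger0_norm// ler_wpM2l.
have phiB t : 0 <= t <= T -> `|phi t| <= M * T.
  move=> tT; rewrite -[phi t]subr0 -phi0; apply: le_trans (phiL _ _ tT _) _.
    by rewrite lexx ltW.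
  by move: tT => /andP[t0 tT]; rewrite subr0 ger0_norm// ler_wpM2l.
(* The Lipschitz constant of the product: [B] and [M * T] bound the factors, [M] and [C] are their
   Lipschitz constants. *)
pose L := B * M + M * T * C.
have L0 : 0 <= L by rewrite addr_ge0// !mulr_ge0// ltW.
have gL s t : 0 <= s <= T -> 0 <= t <= T ->
    `|f s * phi s - f t * phi t| <= L * `|s - t|.
  move=> sT tT.
  have -> : f s * phi s - f t * phi t = f s * (phi s - phi t) + phi t * (f s - f t).
    by ring.
  apply: le_trans (ler_normD _ _) _; rewrite !normrM mulrDl lerD//.
    by rewrite -mulrA; apply: ler_pM => //; [exact: fB|exact: phiL].
  rewrite -(mulrA (M * T)); apply: ler_pM => //; first exact: phiB.
  by move: sT tT => /andP[s0 _] /andP[t0 _]; exact: fL.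
have [w [Kw [mw wK wI dw]]] := lipschitz_density T0 L0 gL.
have mphi : measurable_fun `]0, T[ phi.
  apply: measurable_funTS; apply: continuous_measurable_fun => t.
  by apply/differentiable_continuous/derivable1_diffP; have [] := dphi t.
have mf : measurable_fun `]0, T[ f.
  apply: (@measurable_funS _ _ _ _ `[0, T]%classic) => //.
    exact: subset_itv_oo_cc.
  apply: subspace_continuous_measurable_fun => //.
  exact: lipschitz_within_continuous fL.
have mdphi : measurable_fun `]0, T[ (derive1 phi).
  by apply: measurable_funTS; exact: continuous_measurable_fun.
have oo_cc t : t \in `]0, T[ -> 0 <= t <= T.
  by rewrite in_itv/= => /andP[? ?]; rewrite !ltW.
have i1 : mu.-integrable `]0, T[ (EFin \o (fun t => f t * derive1 phi t)).
  apply: (@bounded_integrable_oo _ _ (B * M)); first exact: measurable_funM.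
  move=> t tT; rewrite normrM; apply: ler_pM => //; first exact/fB/oo_cc.
  by apply: dphiM; rewrite in_itv/= oo_cc.
have i2 : mu.-integrable `]0, T[ (EFin \o (fun t => v t * phi t)).
  apply: (@bounded_integrable_oo _ _ (K * (M * T))).
    by apply: measurable_funM => //; exact: measurable_funTS.
  by move=> t tT; rewrite normrM; apply: ler_pM => //; exact/phiB/oo_cc.
apply/eqP; rewrite -addr_eq0 -RintegralD//; apply/eqP.
transitivity (\int[mu]_(t in `]0, T[) w t); last first.
  by rewrite wI// ?ltW// phi0 phiT !mulr0 subrr.
congr fine; apply: ae_eq_integral => //.
- by apply/measurable_EFinP; apply: measurable_funD; apply: measurable_funM => //;
    exact: measurable_funTS.
- by apply/measurable_EFinP; exact: measurable_funTS.
apply: (@filterS2 _ _ (ae_filter_ringOfSetsType mu) _ _ _ _ dv dw).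
move=> t + + tT; rewrite /= in_itv/= in tT => /(_ tT) dft /(_ tT)[_ <-].
congr EFin; have [_ E] := is_deriveM dft (dphi t).
by rewrite [RHS]E /GRing.scale/= [phi t * _]mulrC.
Qed.

Lemma mx_norm_le_norm1 (N : nat) (u : 'rV[R]_N) : `|u| <= norm1 u.
Proof.
rewrite [`|u|]mx_normrE; apply: bigmax_le => [|[i j] _]; first exact: norm1_ge0.
by rewrite ord1 le_coord_norm1.
Qed.

Lemma bounded_square_integrable (T K : R) (N : nat) (u : R -> 'rV[R]_N) :
  (forall i, measurable_fun `]0, T[ (fun t => u t 0 i)) ->
  (forall i t, t \in `]0, T[ -> `|u t 0 i| <= K) ->
  square_integrable T u.
Proof.
move=> mu_ uK; split => //.
have uE t : enorm (u t) ^+ 2 = \sum_(i < N) u t 0 i * u t 0 i.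
  by rewrite sqr_sqrtr// sumr_ge0// => i _; rewrite -expr2 sqr_ge0.
under eq_integral do rewrite uE.
apply: integrable_lty => //.
apply: (@bounded_integrable_oo _ _ (\sum_(i < N) K * K)).
  by apply: measurable_sum => i; exact: measurable_funM.
move=> t tT; apply: le_trans (ler_norm_sum _ _ _) _.
by apply: ler_sum => i _; rewrite normrM ler_pM// uK.
Qed.

(** Boundedness on a bounded interval gives square integrability of [y] and [v]; the weak derivative
    is checked coordinate by coordinate. *)
Lemma lipschitz_W12 (T C : R) (N : nat) (y v : R -> 'rV[R]_N) : 0 < T -> 0 <= C ->
  (forall s t, 0 <= s -> 0 <= t -> norm1 (y s - y t) <= C * `|s - t|) ->
  (forall i, measurable_fun setT (fun t => v t 0 i) /\
     exists K, forall t, `|v t 0 i| <= K) ->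
  {ae mu, forall t, 0 < t < T -> forall i, is_derive t 1 (fun s => y s 0 i) (v t 0 i)} ->
  exists p : W12 T N, w12_fun p = y /\ w12_deriv p = v.
Proof.
move=> T0 C0 yL mv dv.
have yiL i s t : 0 <= s -> 0 <= t -> `|y s 0 i - y t 0 i| <= C * `|s - t|.
  by move=> s0 t0; apply: le_trans (yL s t s0 t0); rewrite -rowBE le_coord_norm1.
have yc : {within `[0, T], continuous y}.
  apply: (@lipschitz_within_continuous _ _ C) => // s t s0 t0.
  exact: le_trans (mx_norm_le_norm1 _) (yL _ _ s0 t0).
have yL2 : square_integrable T y.
  apply: (@bounded_square_integrable _ (norm1 (y 0) + C * T)).
    move=> i; apply: (@measurable_funS _ _ _ _ `[0, T]%classic) => //.
      exact: subset_itv_oo_cc.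
    apply: subspace_continuous_measurable_fun => //.
    exact: lipschitz_within_continuous (yiL i).
  move=> i t; rewrite in_itv/= => /andP[t0 tT].
  apply: le_trans (le_coord_norm1 _ _) _.
  rewrite -[y t](subrK (y 0)) addrC; apply: le_trans (norm1D _ _) _.
  rewrite lerD2l; apply: le_trans (yL _ _ (ltW t0) (lexx 0)) _.
  by rewrite subr0 gtr0_norm// ler_wpM2l// ltW.
have vL2 : square_integrable T v.
  have /choice[K vK] : forall i, exists K, forall t, `|v t 0 i| <= K.
    by move=> i; have [_] := mv i.
  apply: (@bounded_square_integrable _ (\sum_i `|K i|)).
    by move=> i; apply: measurable_funTS; have [] := mv i.
  move=> i t _; apply: le_trans (vK i t) _; apply: le_trans (ler_norm _) _.
  by rewrite (bigD1 i)//= lerDl sumr_ge0.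
have yv : weak_derivative T y v.
  move=> phi tphi i; have [mvi [K viK]] := mv i.
  apply: (lipschitz_weak_derivative T0 C0 (yiL i) mvi viK) => //.
  apply: (@filterS _ _ (ae_filter_ringOfSetsType mu) _ _ _ dv) => t h tT.
  exact: h.
by exists (Build_W12 yc yL2 vL2 yv).
Qed.

End SobolevLipschitz.

(** * Phase space as concatenated rows, and the Fenchel-Young inequality *)

Section PhaseSpace.
Context {R : realType} {N : nat}.

(** It acts on rows from the right. For [v = row_mx p' q'] the row [- v *m symplectic] is
    [row_mx (- q') p'], the argument of the conjugate in [J]. *)
Definition symplectic : 'M[R]_(N + N) := block_mx 0 (- 1%:M) 1%:M 0.

Lemma mul_symplectic (p q : 'rV[R]_N) : row_mx p q *m symplectic = row_mx q (- p).
Proof. by rewrite mul_row_block !mulmx0 mulmxN !mulmx1 add0r addr0. Qed.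

Lemma symplectic_sqr : symplectic *m symplectic = - 1%:M.
Proof.
rewrite mulmx_block !mulmx0 !mul0mx mulNmx mulmxN !mulmx1 !add0r !addr0.
by rewrite scalar_mx_block opp_block_mx !oppr0.
Qed.

Lemma dotp_row_mx (p q r s : 'rV[R]_N) :
  dotp (row_mx p q) (row_mx r s) = dotp p r + dotp q s.
Proof.
rewrite /dotp big_split_ord; congr (_ + _); apply: eq_bigr => i _.
  by rewrite !row_mxEl.
by rewrite !row_mxEr.
Qed.

Lemma norm1_row_mx (p q : 'rV[R]_N) : norm1 (row_mx p q) = norm1 p + norm1 q.
Proof.
rewrite /norm1 big_split_ord; congr (_ + _); apply: eq_bigr => i _.
  by rewrite row_mxEl.
by rewrite row_mxEr.
Qed.

Lemma norm1_symplectic (u : 'rV[R]_(N + N)) : norm1 (u *m symplectic) = norm1 u.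
Proof.
by rewrite -[u]hsubmxK mul_symplectic !norm1_row_mx norm1N addrC.
Qed.

Lemma dotp_symplectic (u : 'rV[R]_(N + N)) : dotp (u *m symplectic) u = 0.
Proof.
by rewrite -[u]hsubmxK mul_symplectic dotp_row_mx dotpNl dotpC subrr.
Qed.

Lemma enorm_le_norm1 (u : 'rV[R]_N) : enorm u <= norm1 u.
Proof.
rewrite -[leRHS]ger0_norm ?norm1_ge0// -sqrtr_sqr ler_sqrt ?sqr_ge0//.
rewrite expr2 {1}/norm1 mulr_suml; apply: ler_sum => i _.
by apply: le_trans (ler_norm _) _; rewrite normrM ler_wpM2l ?le_coord_norm1.
Qed.

Lemma norm1_le_enorm (u : 'rV[R]_N) : norm1 u <= N%:R * enorm u.
Proof.
have -> : N%:R * enorm u = \sum_(i < N) enorm u.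
  by rewrite sumr_const card_ord mulr_natl.
apply: ler_sum => i _; rewrite -sqrtr_sqr ler_sqrt; last by apply: sumr_ge0 => j _; rewrite -expr2 sqr_ge0.
rewrite /dotp (bigD1 i)//= -expr2 lerDl; apply: sumr_ge0 => j _.
by rewrite -expr2 sqr_ge0.
Qed.

Lemma convex_function_convexf (V : lmodType R) (f : V -> R) :
  convex_function setT f -> convexf f.
Proof.
move=> cf x y t /andP[t0 t1].
by have := cf (Itv01 t0 t1) x y; rewrite !in_setT => /(_ isT isT).
Qed.

(** The supremum defining the conjugate is bounded below by its term at [(p, q)]; where the
    conjugate is infinite, so is the whole sum. *)
Lemma fenchel_young (H : 'rV[R]_N * 'rV[R]_N -> R) (p q p' q' : 'rV[R]_N) :
  (0 <= (H (p, q))%:E + conjugate H (- q', p')%R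
        + (dotp q' p)%:E - (dotp p' q)%:E)%E.
Proof.
have : ((dotp2 (p, q) (- q', p')%R - H (p, q))%:E <= conjugate H (- q', p')%R)%E.
  by apply: ereal_sup_ubound; exists (p, q).
case: (conjugate H _) => [c||]//=; last first.
  by move=> _; rewrite addey// !addye// leey.
rewrite -!EFinD !lee_fin /dotp2/= dotpNr [dotp p _]dotpC [dotp q _]dotpC; lra.
Qed.

(** The subgradient inequality says that the supremum defining the conjugate is attained at
    [(p, q)]. *)
Lemma fenchel_young_eq (H : 'rV[R]_N * 'rV[R]_N -> R) (p q p' q' : 'rV[R]_N) :
  (forall y, H (p, q) + dotp2 (- q', p') (y - (p, q)) <= H y) ->
  ((H (p, q))%:E + conjugate H (- q', p')%R
    + (dotp q' p)%:E - (dotp p' q)%:E = 0)%E.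
Proof.
move=> sub; have -> : conjugate H (- q', p') =
    (dotp2 (p, q) (- q', p') - H (p, q))%:E.
  apply/eqP; rewrite eq_le; apply/andP; split; last first.
    by apply: ereal_sup_ubound; exists (p, q).
  apply: ge_ereal_sup => _ [y _ <-]; rewrite lee_fin.
  have := sub y; rewrite /dotp2/= !dotpBr.
  rewrite (dotpC y.1) (dotpC y.2) (dotpC p) (dotpC q); lra.
rewrite -!EFinD; congr EFin.
rewrite /dotp2/= dotpNr (dotpC p) (dotpC q); ring.
Qed.

End PhaseSpace.

(** * From the flow in phase space to the variational principle *)

Theorem theorem2 (R : realType) (T : R) (N : nat) (p0 q0 : 'rV[R]_N)
    (H : 'rV[R]_N * 'rV[R]_N -> R) (alpha beta r : R)
    (T_gt0 : 0 < T) (N_ge1 : (1 <= N)%N)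
    (H_proper : proper_function (EFin \o H))
    (H_convex : convex_function setT H)
    (H_lsc : lower_semicontinuous (EFin \o H))
    (H_coercive : coercive H)
    (alpha_gt0 : 0 < alpha) (beta_gt0 : 0 < beta) (r_gt1 : 1 < r)
    (H_growth : forall p q : 'rV[R]_N,
       - alpha <= H (p, q) /\
       H (p, q) <= beta * (enorm p `^ r + enorm q `^ r + 1)) :
  ereal_inf [set J H x | x in @D R T N p0 q0] = 0%E /\
  exists x : W12 T N * W12 T N,
    [/\ D p0 q0 x, J H x = 0%E & hamiltonian_solution H p0 q0 x].
Proof.
(* [J] is nonnegative on all of [D], so one solution with [J H x = 0] determines the infimum. *)
suff [x [Dx Jx xH]] : exists x : W12 T N * W12 T N,
    [/\ D p0 q0 x, J H x = 0%E & hamiltonian_solution H p0 q0 x].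
  split; last by exists x.
  apply/eqP; rewrite eq_le; apply/andP; split.
    by apply: ereal_inf_lbound; exists x.
  apply: le_ereal_inf_tmp => _ [[p q] _ <-].
  by apply: integral_ge0 => t _; exact: fenchel_young.
have cH := convex_function_convexf H_convex.
pose G u := H (lsubmx u, rsubmx u).
have cG : convexf G.
  move=> u w t t01; rewrite /G !linearD !linearZ.
  exact: (cH (lsubmx u, rsubmx u) (lsubmx w, rsubmx w)).
(* The added 1 makes the energy outside the ball strictly larger than the initial one. *)
have [M MP] := H_coercive (H (p0, q0) + 1).
(* The factor [N%:R] compares norms: an l1 norm of at least [rho] forces the sum of the two
   Euclidean norms to be at least [M]. *)
pose rho := N%:R * M.
have N0 : 0 < N%:R :> R by rewrite ltr0n.
have GE p q : G (row_mx p q) = H (p, q) by rewrite /G row_mxKl row_mxKr.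
have aG u : - alpha <= G u by have [] := H_growth (lsubmx u) (rsubmx u).
have GB u : norm1 u <= rho + 1 ->
    G u <= beta * ((rho + 1) `^ r + (rho + 1) `^ r + 1).
  rewrite -[u]hsubmxK GE norm1_row_mx; set p := lsubmx u; set q := rsubmx u.
  move=> pq; have [_] := H_growth p q; move/le_trans; apply.
  rewrite ler_wpM2l ?(ltW beta_gt0)// lerD2r.
  have le (w : 'rV[R]_N) : norm1 w <= rho + 1 -> enorm w `^ r <= (rho + 1) `^ r.
    move=> wr; have wr' := le_trans (enorm_le_norm1 w) wr.
    apply: ge0_ler_powR => //; first by lra.
    - by rewrite nnegrE sqrtr_ge0.
    - by rewrite nnegrE (le_trans _ wr')// sqrtr_ge0.
  have := norm1_ge0 p; have := norm1_ge0 q.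
  by move=> ? ?; rewrite lerD// le//; lra.
have Gx0 u : rho <= norm1 u -> G (row_mx p0 q0) < G u.
  rewrite -[u]hsubmxK !GE norm1_row_mx => ru.
  have : M <= enorm (lsubmx u) + enorm (rsubmx u).
    rewrite -(ler_pM2l N0) mulrDr; apply: le_trans ru _.
    by rewrite lerD ?norm1_le_enorm.
  by move=> /MP; apply: lt_le_trans; rewrite ltrDl.
have [x [v [C [[x0E C0] xL mv aev]]]] := coercive_hamiltonian_flow
  T_gt0 symplectic_sqr norm1_symplectic dotp_symplectic cG aG GB Gx0.
have lsubE (u : 'rV[R]_(N + N)) i : lsubmx u 0 i = u 0 (lshift N i).
  by rewrite mxE.
have rsubE (u : 'rV[R]_(N + N)) i : rsubmx u 0 i = u 0 (rshift N i).
  by rewrite mxE.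
have norm1_sub (u : 'rV[R]_(N + N)) :
    norm1 (lsubmx u) <= norm1 u /\ norm1 (rsubmx u) <= norm1 u.
  by rewrite -{2 4}[u]hsubmxK norm1_row_mx lerDl lerDr !norm1_ge0.
have [p [pE p'E]] : exists p : W12 T N,
    w12_fun p = (fun t => lsubmx (x t)) /\ w12_deriv p = (fun t => lsubmx (v t)).
  apply: (lipschitz_W12 T_gt0 C0).
  - move=> s t s0 t0; rewrite -linearB; apply: le_trans (xL s t s0 t0).
    by have [] := norm1_sub (x s - x t).
  - move=> i; have [mvi [K vK]] := mv (lshift N i); split.
      by under eq_fun do rewrite lsubE.
    by exists K => t; rewrite lsubE.
  - apply: (@filterS _ _ (ae_filter_ringOfSetsType _) _ _ _ aev) => t h /h[dx _] i.
    by rewrite lsubE; under eq_fun do rewrite lsubE; exact: dx.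
have [q [qE q'E]] : exists q : W12 T N,
    w12_fun q = (fun t => rsubmx (x t)) /\ w12_deriv q = (fun t => rsubmx (v t)).
  apply: (lipschitz_W12 T_gt0 C0).
  - move=> s t s0 t0; rewrite -linearB; apply: le_trans (xL s t s0 t0).
    by have [] := norm1_sub (x s - x t).
  - move=> i; have [mvi [K vK]] := mv (rshift N i); split.
      by under eq_fun do rewrite rsubE.
    by exists K => t; rewrite rsubE.
  - apply: (@filterS _ _ (ae_filter_ringOfSetsType _) _ _ _ aev) => t h /h[dx _] i.
    by rewrite rsubE; under eq_fun do rewrite rsubE; exact: dx.
have p0E : p 0 = p0 by rewrite pE x0E row_mxKl.
have q0E : q 0 = q0 by rewrite qE x0E row_mxKr.
(* The joint subgradient inequality on the product space gives both the vanishing of the integrand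
   and the two partial inclusions. *)
have aeH : {ae lebesgue_measure, forall t, t \in `]0, T[ -> forall y,
    H (p t, q t) + dotp2 (- w12_deriv q t, w12_deriv p t) (y - (p t, q t)) <= H y}.
  apply: (@filterS _ _ (ae_filter_ringOfSetsType _) _ _ _ aev) => t h.
  rewrite in_itv/= => /h[_ xy] [y1 y2]; rewrite pE qE p'E q'E.
  have := xy (row_mx y1 y2); rewrite GE -{2}(hsubmxK (x t)) -(hsubmxK (v t)).
  rewrite opp_row_mx mul_symplectic opprK opp_row_mx add_row_mx dotp_row_mx.
  by rewrite !row_mxKl !row_mxKr.
exists (p, q); split.
- by split.
- apply: ge0_ae0_integral => //.
    by move=> t _; exact: fenchel_young.
  apply: (@filterS _ _ (ae_filter_ringOfSetsType _) _ _ _ aeH) => t h /h.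
  exact: fenchel_young_eq.
split; last by rewrite p0E q0E.
apply: (@filterS _ _ (ae_filter_ringOfSetsType _) _ _ _ aeH) => t h /h Hpq.
(* Freezing one of the two variables turns the joint inequality into a partial one. *)
split=> y.
- have := Hpq (p t, y); rewrite /dotp2 /= subrr -(scale0r 0) dotpZr mul0r add0r.
  exact.
- have := Hpq (y, q t); rewrite /dotp2 /= subrr -(scale0r 0) dotpZr mul0r addr0.
  exact.
Qed.
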